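(* Let $\theta>0$, $\beta>1$ and $\alpha>0$, let $G_\alpha$ be the cumulative distribution function of the Pseudo-Lindley alpha power transformed distribution with parameters $(\alpha,\beta,\theta)$, and let $x(u)$ denote its quantile function, i.e. for $u\in(0,1)$, $x(u)$ is the solution $x\ge 0$ of the equation $G_\alpha(x)=u$. Then, for every $u\in(0,1)$: (1) if $\alpha=1$, $$x(u)=-\frac{\beta}{\theta}-\frac{1}{\theta}\,W_{-1}\big(\beta(u-1)\exp(-\beta)\big);$$ (2) if $\alpha\in(0,+\infty)\setminus\{1\}$, $$x(u)=-\frac{\beta}{\theta}-\frac{1}{\theta}\,W_{-1}\left(-\beta\exp(-\beta)+\frac{\beta\exp(-\beta)}{\log\alpha}\,\log\big[1-(1-\alpha)u\big]\right).$$
   Context: The Pseudo-Lindley alpha power transformed (PL-APT) distribution with parameters $\alpha>0$, $\beta>1$, $\theta>0$ is the distribution on $[0,\infty)$ whose cumulative distribution function is $G_\alpha(x)=0$ for $x<0$ and, for $x\ge 0$, $$G_{\alpha}(x)=\frac{1-\alpha^{\,1-\beta^{-1}(\beta+\theta x)\exp(-\theta x)}}{1-\alpha}\quad\text{if }\alpha\in(0,+\infty)\setminus\{1\},\qquad G_1(x)=1-\beta^{-1}(\beta+\theta x)\exp(-\theta x).$$ $W_{-1}$ denotes the negative (lower) real branch of the Lambert $W$ function: for $y\in[-1/e,0)$, $W_{-1}(y)$ is the unique real $w\le -1$ such that $w e^{w}=y$. *)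

(* Defs.v *)
From mathcomp Require Import all_boot all_order all_algebra.
From mathcomp Require Import all_classical all_reals all_analysis.

Set Implicit Arguments.
Unset Strict Implicit.
Unset Printing Implicit Defensive.

Import Order.TTheory GRing.Theory Num.Theory.
Import numFieldNormedType.Exports.

Local Open Scope classical_set_scope.
Local Open Scope ring_scope.

(* Cumulative distribution function of the Pseudo-Lindley law PL(beta, theta);
   it is the case alpha = 1 of PL-APT and the base law that the alpha power
   transformation is applied to. *)
Definition pl_cdf (R : realType) (beta theta x : R) : R :=
  if x < 0 then 0
  else 1 - beta^-1 * (beta + theta * x) * expR (- (theta * x)).

Definition plapt_cdf (R : realType) (alpha beta theta x : R) : R :=
  if x < 0 then 0
  else if alpha == 1 then pl_cdf beta theta x
  else (1 - alpha `^ (1 - beta^-1 * (beta + theta * x) * expR (- (theta * x))))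
       / (1 - alpha).

(* Meaningful only when [G x = u] has exactly one solution [x >= 0];
   [get] returns an arbitrary default value when there is none. *)
Definition quantile (R : realType) (G : R -> R) (u : R) : R :=
  get [set x : R | 0 <= x /\ G x = u].

(* Lower real branch of the Lambert W function, meaningful on [-1/e, 0), where
   [w <= -1] and [w e^w = y] determine [w]; outside, no such [w] exists and
   [get] returns an arbitrary default value. *)
Definition lambertWm1 (R : realType) (y : R) : R :=
  get [set w : R | w <= -1 /\ w * expR w = y].

(* Main.v *)
Require Import Defs.
From mathcomp Require Import all_boot all_order all_algebra.
From mathcomp Require Import all_classical all_reals all_analysis.
From mathcomp Require Import ring lra.

Import Order.TTheory GRing.Theory Num.Theory.
Import numFieldNormedType.Exports.

Local Open Scope ring_scope.

(** The alpha power transformation is composition with an increasing bijection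
    of [0, 1], so [G_alpha x = u] is equivalent to [G_1 x = p], where the level
    [p] in ]0, 1[ is [u] itself for [alpha = 1] and
    [ln (1 - (1 - alpha) u) / ln alpha] otherwise ([plapt_cdf_level]).
    The substitution [w = - (beta + theta x)] turns [G_1 x = p] into
    [w e^w = beta (p - 1) e^(- beta)] and [0 <= x] into [w <= - beta]
    ([plapt_cdf_lambert]).  Since [beta > 1], such a [w] lies in the range of
    the lower branch of Lambert's function, where [w e^w] is decreasing
    ([mulexp_decreasing]) with limit 0 at minus infinity.  Its value at
    [- beta] is [- beta e^(- beta)], below the right-hand side, which is
    negative, so the intermediate value theorem gives a solution ([mulexp_surjective]); it is
    unique, and its value is [lambertWm1] of the right-hand side.  Inverting the
    substitution gives the quantile. *)

(** Multiplying by [e^(-w1)], with [d = w2 - w1 > 0], reduces the claim to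
    [d < - w2 (e^d - 1)], which follows from [d < e^d - 1] and [1 <= - w2]. *)
Lemma mulexp_decreasing (R : realType) (w1 w2 : R) :
  w1 < w2 -> w2 <= -1 -> w2 * expR w2 < w1 * expR w1.
Proof.
move=> w12 w2N1; set d := w2 - w1.
have d_gt0 : 0 < d by rewrite subr_gt0.
have expd : 1 + d < expR d by apply: expR_gt1Dx; rewrite gt_eqF.
have -> : expR w2 = expR d * expR w1 by rewrite -expRD /d subrK.
rewrite mulrA ltr_pM2r ?expR_gt0//.
have -> : w1 = w2 - d by rewrite /d; ring.
nra.
Qed.

Lemma mulexp_inj (R : realType) (w1 w2 : R) :
  w1 <= -1 -> w2 <= -1 -> w1 * expR w1 = w2 * expR w2 -> w1 = w2.
Proof.
move=> w1N1 w2N1 w12.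
by have [/mulexp_decreasing/(_ w2N1)|/mulexp_decreasing/(_ w1N1)|//] :=
  ltgtP w1 w2; rewrite w12 ltxx.
Qed.

(** From [e^(-w) = (e^(-w/2))^2 >= (w/2)^2] one gets [w e^w >= 4 / w] for
    [w < 0]: an explicit form of the limit 0 at minus infinity, which shows how
    far left the intermediate value theorem has to start. *)
Lemma mulexp_ge_inv (R : realType) (w : R) : w < 0 -> 4 / w <= w * expR w.
Proof.
move=> w_lt0.
have e_ge := expR_ge1Dx (- w / 2).
have eE : expR (- w) = expR (- w / 2) * expR (- w / 2).
  by rewrite -expRD; congr expR; field.
have quad : w * w <= 4 * expR (- w) by rewrite eE; nra.
rewrite ler_ndivrMr// mulrAC -[w in expR w]opprK expRN.
by rewrite ler_pdivrMr ?expR_gt0.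
Qed.

Lemma mulexp_surjective (R : realType) (b y : R) :
  b * expR b <= y -> y < 0 -> exists2 w, w <= b & w * expR w = y.
Proof.
move=> yb y_lt0.
pose a := Num.min b (4 / y).
have a_lt0 : a < 0.
  by rewrite gt_min; apply/orP; right; rewrite pmulr_rlt0 ?invr_lt0.
have ya : y <= a * expR a.
  apply: le_trans (mulexp_ge_inv _ _ a_lt0).
  rewrite ler_ndivlMr// mulrC -ler_ndivlMr//.
  by rewrite ge_min lexx orbT.
have ab : a <= b by rewrite ge_min lexx.
have cont : ({within `[a, b], continuous (fun w : R => w * expR w)%R})%classic.
  apply: continuous_subspaceT => w.
  by apply: cvgM; [exact: cvg_id|exact: continuous_expR].
have [|w /itvP wab <-] := @IVT R _ a b y ab cont.
  by rewrite ge_min yb orbT le_max ya.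
by exists w => //; rewrite wab.
Qed.

Lemma lambertWm1E (R : realType) (w : R) :
  w <= -1 -> lambertWm1 (w * expR w) = w.
Proof.
move=> wN1; apply: get_unique => // v [vN1].
exact: mulexp_inj.
Qed.

(** The inverse at [u] of the power transformation. *)
Definition plapt_level {R : realType} (alpha u : R) : R :=
  if alpha == 1 then u else ln (1 - (1 - alpha) * u) / ln alpha.

Lemma plapt_level_arg_gt0 (R : realType) (alpha u : R) :
  0 < alpha -> 0 < u -> u < 1 -> 0 < 1 - (1 - alpha) * u.
Proof. by move=> *; nra. Qed.

(** For [alpha < 1] the logarithms are both negative, for [alpha > 1] both
    positive; in either case [1 - (1 - alpha) u] lies strictly between 1 and
    [alpha]. *)
Lemma plapt_level_itv (R : realType) (alpha u : R) :
  0 < alpha -> 0 < u -> u < 1 -> 0 < plapt_level alpha u < 1.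
Proof.
move=> a0 u0 u1; rewrite /plapt_level.
have arg0 := plapt_level_arg_gt0 _ _ _ a0 u0 u1.
case: (ltgtP alpha 1) => a1; last by rewrite u0.
  have lna : ln alpha < 0 by rewrite ln_lt0 ?a0.
  rewrite ltr_ndivlMr// ltr_ndivrMr// mul0r mul1r ltr_ln ?posrE//.
  by rewrite ln_lt0 ?arg0 /=; nra.
have lna : 0 < ln alpha by rewrite ln_gt0.
rewrite ltr_pdivlMr// ltr_pdivrMr// mul0r mul1r ltr_ln ?posrE//.
by rewrite ln_gt0 /=; nra.
Qed.

Lemma plapt_cdf_level (R : realType) (alpha beta theta x u : R) :
  0 < alpha -> 0 < u -> u < 1 -> 0 <= x ->
  plapt_cdf alpha beta theta x = u <->
  pl_cdf beta theta x = plapt_level alpha u.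
Proof.
move=> a0 u0 u1 x0; rewrite /plapt_cdf /pl_cdf /plapt_level ltNge x0 /=.
have [//|aN1] := eqVneq alpha 1.
set q := 1 - _ * expR _.
have arg0 := plapt_level_arg_gt0 _ _ _ a0 u0 u1.
have lna : ln alpha != 0 by rewrite ln_eq0.
have Da : 1 - alpha != 0 by rewrite subr_eq0 eq_sym.
split=> [<-|->].
  have -> : 1 - (1 - alpha) * ((1 - alpha `^ q) / (1 - alpha)) = alpha `^ q.
    by field.
  by rewrite ln_powR mulfK.
have -> : alpha `^ (ln (1 - (1 - alpha) * u) / ln alpha)
          = 1 - (1 - alpha) * u.
  by rewrite /powR gt_eqF// divfK// lnK// posrE.
by field.
Qed.

Lemma plapt_cdf_lambert (R : realType) (alpha beta theta w u : R) :
  0 < alpha -> 1 < beta -> 0 < theta -> 0 < u -> u < 1 -> w <= - beta ->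
  plapt_cdf alpha beta theta (- (beta / theta) - theta^-1 * w) = u <->
  w * expR w = beta * (plapt_level alpha u - 1) * expR (- beta).
Proof.
move=> a0 b1 t0 u0 u1 wb.
have tn0 : theta != 0 by rewrite gt_eqF.
have bn0 : beta != 0 by rewrite gt_eqF// (lt_trans _ b1).
set x := _ - _ * w.
have txE : theta * x = - beta - w by rewrite /x; field.
have x0 : 0 <= x by rewrite -(pmulr_rge0 _ t0) txE; lra.
rewrite plapt_cdf_level// /pl_cdf ltNge x0 /= txE.
have -> : - (- beta - w) = beta + w by ring.
rewrite expRD expRN; set p := plapt_level _ _.
have En0 : expR beta != 0 by rewrite gt_eqF ?expR_gt0.
split=> [<-|wE]; first by field; rewrite bn0 En0.
have -> : 1 - beta^-1 * (beta + (- beta - w)) * (expR beta * expR w)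
  = 1 + beta^-1 * expR beta * (w * expR w) by ring.
by rewrite wE; field; rewrite bn0 En0.
Qed.

(** Stating the argument of Lambert's function through the level [p] treats
    [alpha = 1] and [alpha <> 1] at once.  Uniqueness comes from injectivity of
    [w e^w] on [w <= -1] through the substitution, which sends [0 <= z] to
    [w <= - beta < -1]. *)
Lemma plapt_quantile (R : realType) (alpha beta theta u : R) :
  0 < alpha -> 1 < beta -> 0 < theta -> 0 < u -> u < 1 ->
  let x := - (beta / theta) - theta^-1 *
    lambertWm1 (beta * (plapt_level alpha u - 1) * expR (- beta)) in
  (0 <= x /\ plapt_cdf alpha beta theta x = u) /\
  forall z, 0 <= z /\ plapt_cdf alpha beta theta z = u -> x = z.
Proof.
move=> a0 b1 t0 u0 u1 x.
have tn0 : theta != 0 by rewrite gt_eqF.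
have /andP[p0 p1] := plapt_level_itv _ _ _ a0 u0 u1.
rewrite /x {x}; set y := beta * _ * _.
have e0 : 0 < expR (- beta) by exact: expR_gt0.
have yb : - beta * expR (- beta) <= y by rewrite /y ler_pM2r//; nra.
have y0 : y < 0 by rewrite /y pmulr_llt0//; nra.
have [w wb wE] := mulexp_surjective _ _ _ yb y0.
have wN1 : w <= -1 by lra.
have -> : lambertWm1 y = w by rewrite -wE lambertWm1E.
split; first split.
- rewrite -(pmulr_rge0 _ t0).
  have -> : theta * (- (beta / theta) - theta^-1 * w) = - beta - w by field.
  lra.
- exact/plapt_cdf_lambert.
- move=> z [z0 zu].
  pose v := - (beta + theta * z).
  have zE : z = - (beta / theta) - theta^-1 * v by rewrite /v; field.
  have vb : v <= - beta by rewrite /v; nra.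
  move: zu; rewrite zE => /plapt_cdf_lambert vE.
  congr (_ - _ * _); apply: mulexp_inj => //; first lra.
  by rewrite wE vE.
Qed.

Theorem mainTheorem1 (R : realType) (alpha beta theta : R)
    (alpha_gt0 : 0 < alpha) (beta_gt1 : 1 < beta) (theta_gt0 : 0 < theta)
    (u : R) (u_gt0 : 0 < u) (u_lt1 : u < 1) :
  (exists! x : R, 0 <= x /\ plapt_cdf alpha beta theta x = u) /\
  (alpha = 1 ->
     quantile (plapt_cdf alpha beta theta) u =
       - (beta / theta)
       - theta^-1 * lambertWm1 (beta * (u - 1) * expR (- beta))) /\
  (alpha <> 1 ->
     quantile (plapt_cdf alpha beta theta) u =
       - (beta / theta)
       - theta^-1 *
         lambertWm1 (- (beta * expR (- beta))
                     + beta * expR (- beta) / ln alpha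
                       * ln (1 - (1 - alpha) * u))).
Proof.
have [xu uniq_x] := plapt_quantile _ _ _ _ _
  alpha_gt0 beta_gt1 theta_gt0 u_gt0 u_lt1.
have qE : quantile (plapt_cdf alpha beta theta) u = - (beta / theta) - theta^-1 *
    lambertWm1 (beta * (plapt_level alpha u - 1) * expR (- beta)).
  by apply: get_unique => // z /uniq_x ->.
split; first by eexists; split; [exact: xu|exact: uniq_x].
split=> [a1|/eqP aN1]; rewrite qE /plapt_level; first by rewrite a1 eqxx.
rewrite (negbTE aN1); congr (_ - _ * lambertWm1 _).
by ring.
Qed.
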